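(* Let $V$ be a complex vector space and let $R\in\mathrm{Aut}(V\otimes V)$ be an $r$-matrix, i.e. an automorphism of $V\otimes V$ satisfying the Yang-Baxter equation $$(R\otimes\mathrm{id})\circ(\mathrm{id}\otimes R)\circ(R\otimes\mathrm{id})=(\mathrm{id}\otimes R)\circ(R\otimes\mathrm{id})\circ(\mathrm{id}\otimes R)\in\mathrm{End}(V^{\otimes3}).$$ Then for every $n\ge2$ there is a representation $\rho_R:B_n\to\mathrm{Aut}(V^{\otimes n})$ of the braid group defined by $$\sigma_i\mapsto\mathrm{id}^{\otimes(i-1)}\otimes R\otimes\mathrm{id}^{\otimes(n-i-1)},\qquad 1\le i\le n-1.$$
   Context: The braid group $B_n$ is the group generated by $\sigma_1,\dots,\sigma_{n-1}$ modulo the relations $\sigma_i\sigma_{i+1}\sigma_i=\sigma_{i+1}\sigma_i\sigma_{i+1}$ for $1\le i\le n-2$ and $\sigma_i\sigma_j=\sigma_j\sigma_i$ for $|i-j|\ge2$. *)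

(* Defs.v *)
From HB Require Import structures.
From mathcomp Require Import all_boot all_order all_algebra.
From mathcomp Require Import sesquilinear ring_quotient.
From mathcomp Require Import freeg.
From mathcomp Require Import boolp.
From mathcomp Require Export reals complex.

Set Implicit Arguments.
Unset Strict Implicit.
Unset Printing Implicit Defensive.

Import GRing.Theory.
Local Open Scope ring_scope.
Local Open Scope quotient_scope.

Section FreeModule.
Variables (K : comNzRingType) (T : choiceType).
Local Notation free := {freeg T / K}.

Lemma scale_freegU (a c : K) (x : T) : a *: << c *g x >> = << a * c *g x >> :> free.
Proof. by apply/eqP/freeg_eqP => k; rewrite coeffZ !coeffU mulrA. Qed.

Variables (W : lmodType K) (f : T -> W).

Fact fglift_additive : zmod_morphism (fglift f : free -> W).
Proof. exact: lift_is_additive. Qed.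

HB.instance Definition _ :=
  GRing.isZmodMorphism.Build free W (fglift f) fglift_additive.

Fact fglift_scalable : scalable (fglift f : free -> W).
Proof.
move=> a x; rewrite -(freeg_sumE x) scaler_sumr !raddf_sum /=.
by apply: eq_bigr => z _; rewrite scale_freegU !liftU scalerA.
Qed.

HB.instance Definition _ :=
  GRing.isScalable.Build K free W *:%R (fglift f) fglift_scalable.

End FreeModule.

(* Tensor product of two modules of arbitrary rank: the free module on U * V
   modulo the submodule generated by the bilinearity relations. *)
Section TensorQuotient.
Variables (K : comNzRingType) (U V : lmodType K).

Local Notation free := {freeg (U * V)%type / K}.
Local Notation "<[ u , v ]>" := (<< (u, v) >> : free).

Inductive tensor_null : free -> Prop :=
| TNullDl u u' v : tensor_null (<[u + u', v]> - <[u, v]> - <[u', v]>)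
| TNullDr u v v' : tensor_null (<[u, v + v']> - <[u, v]> - <[u, v']>)
| TNullZl a u v : tensor_null (<[a *: u, v]> - a *: <[u, v]>)
| TNullZr a u v : tensor_null (<[u, a *: v]> - a *: <[u, v]>)
| TNull0 : tensor_null 0
| TNullP a x y : tensor_null x -> tensor_null y -> tensor_null (a *: x + y).

Definition tensor_nullb : {pred free} := fun x => `[< tensor_null x >].

Lemma tensor_nullP x : reflect (tensor_null x) (x \in tensor_nullb).
Proof. exact: asboolP. Qed.

Fact tensor_null_zmod_closed : zmod_closed tensor_nullb.
Proof.
split=> [|x y /tensor_nullP xN /tensor_nullP yN]; apply/tensor_nullP.
  exact: TNull0.
by rewrite addrC -scaleN1r; apply: TNullP.
Qed.

HB.instance Definition _ :=
  GRing.isZmodClosed.Build free tensor_nullb tensor_null_zmod_closed.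

Definition tensorq : Type := @Quotient.quot free tensor_nullb.

HB.instance Definition _ := GRing.Zmodule.on tensorq.
HB.instance Definition _ : EqQuotient free _ tensorq := EqQuotient.on tensorq.

Fact tensor_pi_additive : zmod_morphism (\pi_tensorq : free -> tensorq).
Proof. by move=> x y; rewrite [LHS]Quotient.pi_add; congr (_ + _); apply: Quotient.pi_opp. Qed.

Definition tensor_pi (x : free) : tensorq := \pi_tensorq x.

HB.instance Definition _ :=
  GRing.isZmodMorphism.Build free tensorq tensor_pi tensor_pi_additive.

Lemma tensor_eqP (x y : free) :
  tensor_null (x - y) <-> tensor_pi x = tensor_pi y.
Proof.
split=> [xyN|].
  by apply/eqP; rewrite -[_ == _]Quotient.idealrBE; apply/tensor_nullP.
by move/eqP; rewrite -[_ == _]Quotient.idealrBE => /tensor_nullP.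
Qed.

Lemma tensor_piK (t : tensorq) : tensor_pi (repr t) = t.
Proof. exact: reprK. Qed.

Definition tensor_scale (a : K) (t : tensorq) : tensorq :=
  tensor_pi (a *: repr t).

Lemma tensor_scale_pi (a : K) (x : free) :
  tensor_scale a (tensor_pi x) = tensor_pi (a *: x).
Proof.
apply/tensor_eqP; rewrite -scalerBr -[_ *: _]addr0.
by apply: TNullP TNull0; apply/tensor_eqP; rewrite tensor_piK.
Qed.

Fact tensor_scaleA a b t :
  tensor_scale a (tensor_scale b t) = tensor_scale (a * b) t.
Proof. by rewrite -[t]tensor_piK !tensor_scale_pi scalerA. Qed.

Fact tensor_scale1 : left_id 1 tensor_scale.
Proof. by move=> t; rewrite -[t]tensor_piK tensor_scale_pi scale1r. Qed.

Fact tensor_scaleDr : right_distributive tensor_scale +%R.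
Proof.
move=> a s t; rewrite -[s]tensor_piK -[t]tensor_piK.
by rewrite -raddfD !tensor_scale_pi -raddfD scalerDr.
Qed.

Fact tensor_scaleDl t : {morph tensor_scale^~ t : a b / a + b}.
Proof.
by move=> a b; rewrite -[t]tensor_piK !tensor_scale_pi -raddfD scalerDl.
Qed.

HB.instance Definition _ := GRing.Zmodule_isLmodule.Build K tensorq
  tensor_scaleA tensor_scale1 tensor_scaleDr tensor_scaleDl.

Fact tensor_pi_scalable : scalable tensor_pi.
Proof. by move=> a x; rewrite -tensor_scale_pi. Qed.

HB.instance Definition _ :=
  GRing.isScalable.Build K free tensorq *:%R tensor_pi tensor_pi_scalable.

Definition tensq (u : U) (v : V) : tensorq := tensor_pi <[u, v]>.

Fact tensq_is_bilinear : bilinear_for *:%R *:%R tensq.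
Proof.
split=> [v|u] a x y; rewrite /tensq -linearZ -linearD; apply/tensor_eqP.
  rewrite opprD addrA.
  have -> : <[a *: x + y, v]> - a *: <[x, v]> - <[y, v]> =
     1 *: (<[a *: x + y, v]> - <[a *: x, v]> - <[y, v]>) +
     (<[a *: x, v]> - a *: <[x, v]>).
    by rewrite scale1r [RHS]addrAC addrA subrK.
  exact: TNullP (TNullDl _ _ _) (TNullZl _ _ _).
rewrite opprD addrA.
have -> : <[u, a *: x + y]> - a *: <[u, x]> - <[u, y]> =
   1 *: (<[u, a *: x + y]> - <[u, a *: x]> - <[u, y]>) +
   (<[u, a *: x]> - a *: <[u, x]>).
  by rewrite scale1r [RHS]addrAC addrA subrK.
exact: TNullP (TNullDr _ _ _) (TNullZr _ _ _).
Qed.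

HB.instance Definition _ :=
  bilinear_isBilinear.Build K U V tensorq *:%R *:%R tensq tensq_is_bilinear.

Section Lift.
Variables (W : lmodType K) (b : {bilinear U -> V -> W}).

Local Notation flift := (fglift (fun p : U * V => b p.1 p.2)).

Fact flift_null x : tensor_null x -> flift x = 0.
Proof.
elim=> {x} [u u' v|u v v'|a u v|a u v||a x y _ IHx _ IHy].
- by rewrite !raddfB /= !liftU !scale1r /= linearDl addrAC addrK subrr.
- by rewrite !raddfB /= !liftU !scale1r /= linearDr addrAC addrK subrr.
- by rewrite linearB linearZ /= !liftU !scale1r /= linearZl_LR subrr.
- by rewrite linearB linearZ /= !liftU !scale1r /= linearZr_LR subrr.
- exact: raddf0.
- by rewrite linearD linearZ /= IHx IHy scaler0 addr0.
Qed.

(* The linear map induced by a bilinear map. *)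
Definition tliftq (t : tensorq) : W := flift (repr t).

Lemma tliftq_pi (x : free) : tliftq (tensor_pi x) = flift x.
Proof.
apply/eqP; rewrite -subr_eq0 -raddfB; apply/eqP/flift_null.
by apply/tensor_eqP; rewrite tensor_piK.
Qed.

Lemma tliftqE u v : tliftq (tensq u v) = b u v.
Proof. by rewrite tliftq_pi liftU scale1r. Qed.

Fact tliftq_linear : linear tliftq.
Proof.
move=> a s t; rewrite -[s]tensor_piK -[t]tensor_piK -linearP.
by rewrite !tliftq_pi linearP.
Qed.

HB.instance Definition _ :=
  GRing.isLinear.Build K tensorq W *:%R tliftq tliftq_linear.

End Lift.

Lemma tensorq_ext (W : lmodType K) (f g : {linear tensorq -> W}) :
  (forall u v, f (tensq u v) = g (tensq u v)) -> f =1 g.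
Proof.
move=> fg t; rewrite -[t]tensor_piK -(freeg_sumE (repr t)) !raddf_sum.
apply: eq_bigr => -[u v] _ /=.
by rewrite -[X in << X *g _ >>]mulr1 -scale_freegU !linearZ /= fg.
Qed.

End TensorQuotient.

(* tensor U V is tensorq U V, tens is tensq and tlift is tliftq, up to an opaque
   key that prevents conversion from unfolding the construction: use the lemmas
   below. *)
Fact tensor_key : unit. Proof. exact: tt. Qed.

Definition tensor (K : comNzRingType) (U V : lmodType K) : lmodType K :=
  locked_with tensor_key (tensorq U V : lmodType K).

Section Tensor.
Variables (K : comNzRingType) (U V : lmodType K).

Definition tens : U -> V -> tensor U V :=
  match tensor_key as k return U -> V -> locked_with k (tensorq U V : lmodType K)
  with tt => @tensq K U V end.

Fact tens_is_bilinear : bilinear_for *:%R *:%R tens.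
Proof.
by rewrite /tens /tensor; case: tensor_key; apply: tensq_is_bilinear.
Qed.

HB.instance Definition _ :=
  bilinear_isBilinear.Build K U V (tensor U V) *:%R *:%R tens tens_is_bilinear.

Lemma tensPl a u u' v : tens (a *: u + u') v = a *: tens u v + tens u' v.
Proof. exact: linearPl. Qed.

Lemma tensPr a u v v' : tens u (a *: v + v') = a *: tens u v + tens u v'.
Proof. exact: linearPr. Qed.

Definition tlift (W : lmodType K) (b : {bilinear U -> V -> W}) :
    {linear tensor U V -> W} :=
  match tensor_key as k
    return {linear locked_with k (tensorq U V : lmodType K) -> W}
  with tt => tliftq b end.

Lemma tliftE (W : lmodType K) (b : {bilinear U -> V -> W}) u v :
  tlift b (tens u v) = b u v.
Proof.
by rewrite /tlift /tens /tensor; case: tensor_key; apply: tliftqE.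
Qed.

(* Pure tensors span, so linear maps are determined by their values on them. *)
Lemma tensor_ext (W : lmodType K) (f g : {linear tensor U V -> W}) :
  (forall u v, f (tens u v) = g (tens u v)) -> f =1 g.
Proof.
move: f g; rewrite /tens /tensor; case: tensor_key; exact: tensorq_ext.
Qed.

End Tensor.

Arguments tens {K U V} u v.
Global Opaque tensor tens tlift.

Notation "U ⊗ V" := (tensor U V) (at level 40, left associativity).
Notation "u ⊗ₜ v" := (tens u v) (at level 40, left associativity).

Section TensorMap.
Variables (K : comNzRingType) (U U' V V' : lmodType K).
Variables (f : {linear U -> U'}) (g : {linear V -> V'}).

Definition tmap_fun (u : U) (v : V) : U' ⊗ V' := f u ⊗ₜ g v.

Fact tmap_fun_is_bilinear : bilinear_for *:%R *:%R tmap_fun.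
Proof.
by split=> [v|u] a x y; rewrite /tmap_fun linearP ?tensPl ?tensPr.
Qed.

HB.instance Definition _ :=
  bilinear_isBilinear.Build K U V (U' ⊗ V') *:%R *:%R tmap_fun
    tmap_fun_is_bilinear.

(* The tensor product f ⊗ g of linear maps. *)
Definition tmap : {linear (U ⊗ V) -> (U' ⊗ V')} := tlift tmap_fun.

Lemma tmapE u v : tmap (u ⊗ₜ v) = f u ⊗ₜ g v.
Proof. exact: tliftE. Qed.

End TensorMap.

Section Assoc.
Variables (K : comNzRingType) (U V W : lmodType K).

Definition assocr_fun2 (w : W) (u : U) (v : V) : U ⊗ (V ⊗ W) := u ⊗ₜ (v ⊗ₜ w).

Fact assocr_fun2_is_bilinear w : bilinear_for *:%R *:%R (assocr_fun2 w).
Proof.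
by split=> [v|u] a x y; rewrite /assocr_fun2 tensPl ?tensPr.
Qed.

HB.instance Definition _ w :=
  bilinear_isBilinear.Build K U V (U ⊗ (V ⊗ W)) *:%R *:%R (assocr_fun2 w)
    (assocr_fun2_is_bilinear w).

Definition assocr_fun (t : U ⊗ V) (w : W) : U ⊗ (V ⊗ W) :=
  tlift (assocr_fun2 w) t.

Fact assocr_fun_is_bilinear : bilinear_for *:%R *:%R assocr_fun.
Proof.
split=> [w|t] a x y; rewrite /assocr_fun ?linearP //.
pose s : {linear (U ⊗ V) -> (U ⊗ (V ⊗ W))} :=
  a \*: tlift (assocr_fun2 x) \+ tlift (assocr_fun2 y).
apply: (@tensor_ext _ _ _ _ (tlift (assocr_fun2 (a *: x + y))) s) => u v /=.
by rewrite !tliftE /= /assocr_fun2 !tensPr.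
Qed.

HB.instance Definition _ :=
  bilinear_isBilinear.Build K (U ⊗ V) W (U ⊗ (V ⊗ W)) *:%R *:%R
    assocr_fun assocr_fun_is_bilinear.

(* The canonical isomorphism (u ⊗ₜ v) ⊗ₜ w |-> u ⊗ₜ (v ⊗ₜ w). *)
Definition assocr : {linear ((U ⊗ V) ⊗ W) -> (U ⊗ (V ⊗ W))} :=
  tlift assocr_fun.

Lemma assocrE u v w : assocr ((u ⊗ₜ v) ⊗ₜ w) = u ⊗ₜ (v ⊗ₜ w).
Proof. by rewrite [LHS]tliftE [LHS]tliftE. Qed.

Definition assocl_fun2 (u : U) (v : V) (w : W) : (U ⊗ V) ⊗ W := (u ⊗ₜ v) ⊗ₜ w.

Fact assocl_fun2_is_bilinear u : bilinear_for *:%R *:%R (assocl_fun2 u).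
Proof.
by split=> [w|v] a x y; rewrite /assocl_fun2 tensPr ?tensPl.
Qed.

HB.instance Definition _ u :=
  bilinear_isBilinear.Build K V W ((U ⊗ V) ⊗ W) *:%R *:%R (assocl_fun2 u)
    (assocl_fun2_is_bilinear u).

Definition assocl_fun (u : U) (t : V ⊗ W) : (U ⊗ V) ⊗ W :=
  tlift (assocl_fun2 u) t.

Fact assocl_fun_is_bilinear : bilinear_for *:%R *:%R assocl_fun.
Proof.
split=> [t|u] a x y; rewrite /assocl_fun ?linearP //.
pose s : {linear (V ⊗ W) -> ((U ⊗ V) ⊗ W)} :=
  a \*: tlift (assocl_fun2 x) \+ tlift (assocl_fun2 y).
apply: (@tensor_ext _ _ _ _ (tlift (assocl_fun2 (a *: x + y))) s) => v w /=.
by rewrite !tliftE /= /assocl_fun2 !tensPl.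
Qed.

HB.instance Definition _ :=
  bilinear_isBilinear.Build K U (V ⊗ W) ((U ⊗ V) ⊗ W) *:%R *:%R
    assocl_fun assocl_fun_is_bilinear.

Definition assocl : {linear (U ⊗ (V ⊗ W)) -> ((U ⊗ V) ⊗ W)} :=
  tlift assocl_fun.

Lemma assoclE u v w : assocl (u ⊗ₜ (v ⊗ₜ w)) = (u ⊗ₜ v) ⊗ₜ w.
Proof. by rewrite [LHS]tliftE [LHS]tliftE. Qed.

End Assoc.

Arguments assocr {K U V W}.
Arguments assocl {K U V W}.
Global Opaque tmap assocr assocl.

(* Tensor powers V^{⊗n}, associated to the right, with V^{⊗2} = V ⊗ V and
   V^{⊗3} = V ⊗ (V ⊗ V) definitionally. *)
Fixpoint tpow (K : comNzRingType) (V : lmodType K) (n : nat) : lmodType K :=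
  match n with
  | 0 => K^o
  | m.+1 => if m is 0 then V else V ⊗ tpow V m
  end.

Section YangBaxter.
Variables (K : comNzRingType) (V : lmodType K).
Variable R : {linear V ⊗ V -> V ⊗ V}.

(* R ⊗ id_W, viewed on V ⊗ (V ⊗ W) through associativity. *)
Definition act_head (W : lmodType K) :
    {linear V ⊗ (V ⊗ W) -> V ⊗ (V ⊗ W)} :=
  assocr \o tmap R (@idfun W) \o assocl.

Definition yang_baxter : Prop :=
  act_head V \o tmap (@idfun V) R \o act_head V
  =1 tmap (@idfun V) R \o act_head V \o tmap (@idfun V) R.

(* R ⊗ id^{⊗(n-2)} on V^{⊗n}; the identity by convention when n < 2. *)
Definition act_first (n : nat) : {linear tpow V n -> tpow V n} :=
  match n with
  | 0 | 1 => idfun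
  | 2 => R
  | m.+3 => act_head (tpow V m.+1)
  end.

(* id_V ⊗ f on V^{⊗(n+1)}; the identity by convention when n = 0. *)
Definition act_tail (n : nat) :
    {linear tpow V n -> tpow V n} -> {linear tpow V n.+1 -> tpow V n.+1} :=
  match n with
  | 0 => fun=> idfun
  | m.+1 => fun f => tmap idfun f
  end.

(* id^{⊗i} ⊗ R ⊗ id^{⊗(n-i-2)} on V^{⊗n}, where i counts from 0; the identity
   by convention when i + 2 > n. *)
Fixpoint act_at (n i : nat) : {linear tpow V n -> tpow V n} :=
  match n with
  | 0 => idfun
  | m.+1 => if i is j.+1 then act_tail (act_at m j) else act_first m.+1
  end.

End YangBaxter.

Section LinearAut.
Variables (K : comNzRingType) (W : lmodType K).

Record linear_aut := LinearAut {
  linear_aut_val :> {linear W -> W};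
  linear_aut_bij : bijective linear_aut_val
}.

HB.instance Definition _ := gen_eqMixin linear_aut.
HB.instance Definition _ := gen_choiceMixin linear_aut.

Lemma linear_autP (f g : linear_aut) : f =1 g <-> f = g.
Proof.
split=> [fg|-> //]; case: f g fg => f fB [g gB] /= fg.
have {}fg : f = g.
  case: f fg {fB} => f [[fA] [fS]]; case: g {gB} => g [[gA] [gS]] /= /funext fg.
  case: g / fg in gA gS *.
  by rewrite (Prop_irrelevance fA gA) (Prop_irrelevance fS gS).
by case: g / fg in gB *; rewrite (Prop_irrelevance fB gB).
Qed.

Definition linear_aut_one : linear_aut :=
  @LinearAut idfun (inv_bij (fun=> erefl)).

Definition linear_aut_mul (f g : linear_aut) : linear_aut :=
  @LinearAut (f \o g) (bij_comp (linear_aut_bij f) (linear_aut_bij g)).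

Section Inverse.
Variable f : linear_aut.

Fact linear_aut_can : {h : W -> W | cancel f h & cancel h f}.
Proof.
by apply: cid2; case: (linear_aut_bij f) => h fK hK; exists h.
Qed.

Definition linear_aut_inv_fun : W -> W := s2val linear_aut_can.

Fact linear_aut_inv_funK : cancel linear_aut_inv_fun f.
Proof. exact: (s2valP' linear_aut_can). Qed.

Fact linear_aut_funK : cancel f linear_aut_inv_fun.
Proof. exact: (s2valP linear_aut_can). Qed.

Fact linear_aut_inv_linear : linear linear_aut_inv_fun.
Proof.
move=> a x y; apply: (can_inj linear_aut_funK).
by rewrite linearP !linear_aut_inv_funK.
Qed.

HB.instance Definition _ :=
  GRing.isLinear.Build K W W *:%R linear_aut_inv_fun linear_aut_inv_linear.

Definition linear_aut_inv : linear_aut :=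
  @LinearAut linear_aut_inv_fun
    (Bijective linear_aut_inv_funK linear_aut_funK).

End Inverse.

Fact linear_aut_mulA : associative linear_aut_mul.
Proof. by move=> f g h; apply/linear_autP. Qed.

Fact linear_aut_mul1 : left_id linear_aut_one linear_aut_mul.
Proof. by move=> f; apply/linear_autP. Qed.

Fact linear_aut_mulr1 : right_id linear_aut_one linear_aut_mul.
Proof. by move=> f; apply/linear_autP. Qed.

Fact linear_aut_mulV : left_inverse linear_aut_one linear_aut_inv linear_aut_mul.
Proof. by move=> f; apply/linear_autP => x /=; rewrite linear_aut_funK. Qed.

Fact linear_aut_mulrV :
  right_inverse linear_aut_one linear_aut_inv linear_aut_mul.
Proof. by move=> f; apply/linear_autP => x /=; rewrite linear_aut_inv_funK. Qed.

HB.instance Definition _ := isGroup.Build linear_aut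
  linear_aut_mulA linear_aut_mul1 linear_aut_mulr1
  linear_aut_mulV linear_aut_mulrV.

End LinearAut.

(* The group <I | rel> presented by generators I and relators l = r for
   rel l r: words in the letters (i, false) = i and (i, true) = i^-1, modulo the
   congruence generated by free cancellation and by rel. *)
Section Presentation.
Variables (I : choiceType) (rel : seq (I * bool) -> seq (I * bool) -> Prop).

Local Notation word := (seq (I * bool)).

Inductive pres_eq : word -> word -> Prop :=
| PresRefl w : pres_eq w w
| PresSym u v : pres_eq u v -> pres_eq v u
| PresTrans u v w : pres_eq u v -> pres_eq v w -> pres_eq u w
| PresCat u u' v v' : pres_eq u u' -> pres_eq v v' -> pres_eq (u ++ v) (u' ++ v')
| PresCancel i b : pres_eq [:: (i, b); (i, ~~ b)] [::]
| PresRel l r : rel l r -> pres_eq l r.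

Definition pres_eqb (u v : word) : bool := `[< pres_eq u v >].

Fact pres_eqb_equiv : equiv_class_of pres_eqb.
Proof.
split=> [u|u v|v u w].
- exact/asboolP/PresRefl.
- by apply/asboolP/asboolP; apply: PresSym.
- by move=> /asboolP uv /asboolP vw; apply/asboolP/(PresTrans uv vw).
Qed.

Canonical pres_eqb_equivRel := EquivRelPack pres_eqb_equiv.
Canonical pres_eqb_encModRel := defaultEncModRel pres_eqb.

Definition presented : Type := {eq_quot pres_eqb}.

HB.instance Definition _ : EqQuotient word pres_eqb presented :=
  EqQuotient.on presented.
HB.instance Definition _ := Choice.on presented.

Lemma presented_eqP (u v : word) :
  pres_eq u v <-> \pi_presented u = \pi_presented v.
Proof.
split=> [uv|/eqP]; first by apply/eqP; rewrite piE; apply/asboolP.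
by rewrite piE => /asboolP.
Qed.

Definition word_inv (w : word) : word := [seq (x.1, ~~ x.2) | x <- rev w].

Definition presented_one : presented := \pi_presented [::].
Definition presented_mul (x y : presented) : presented :=
  \pi_presented (repr x ++ repr y).
Definition presented_inv (x : presented) : presented :=
  \pi_presented (word_inv (repr x)).

Lemma presented_mul_pi u v :
  presented_mul (\pi_presented u) (\pi_presented v) = \pi_presented (u ++ v).
Proof. by apply/presented_eqP/PresCat; apply/presented_eqP; rewrite reprK. Qed.

Lemma pres_mulVw w : pres_eq (word_inv w ++ w) [::].
Proof.
rewrite /word_inv; elim: w => [|[i b] w IH]; first exact: PresRefl.
rewrite rev_cons map_rcons cat_rcons /=.
rewrite -[_ :: _ :: w]/([:: (i, ~~ b); (i, b)] ++ w) catA.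
apply: PresTrans IH; apply: PresCat (PresRefl w).
rewrite -[X in pres_eq _ X]cats0; apply: PresCat (PresRefl _) _.
by rewrite -{2}[b]negbK; apply: PresCancel.
Qed.

Lemma pres_mulwV w : pres_eq (w ++ word_inv w) [::].
Proof.
have := pres_mulVw (word_inv w); congr pres_eq; congr (_ ++ _).
rewrite /word_inv -map_rev revK -map_comp -[RHS]map_id.
by apply: eq_map => -[i b] /=; rewrite negbK.
Qed.

Fact presented_mulA : associative presented_mul.
Proof.
move=> x y z; rewrite -[x]reprK -[y]reprK -[z]reprK.
rewrite (presented_mul_pi (repr y)) (presented_mul_pi (repr x)).
by rewrite (presented_mul_pi (repr x)) (presented_mul_pi _ (repr z)) catA.
Qed.

Fact presented_mul1 : left_id presented_one presented_mul.
Proof. by move=> x; rewrite -[x]reprK presented_mul_pi. Qed.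

Fact presented_mulr1 : right_id presented_one presented_mul.
Proof. by move=> x; rewrite -[x]reprK presented_mul_pi cats0. Qed.

Fact presented_mulV : left_inverse presented_one presented_inv presented_mul.
Proof.
move=> x; rewrite -{2}[x]reprK presented_mul_pi.
exact/presented_eqP/pres_mulVw.
Qed.

Fact presented_mulrV : right_inverse presented_one presented_inv presented_mul.
Proof.
move=> x; rewrite -{1}[x]reprK presented_mul_pi.
exact/presented_eqP/pres_mulwV.
Qed.

HB.instance Definition _ := isGroup.Build presented
  presented_mulA presented_mul1 presented_mulr1 presented_mulV presented_mulrV.

Definition pres_gen (i : I) : presented := \pi_presented [:: (i, false)].

End Presentation.

Section Braid.
Variable n : nat.

(* 'I_n.-1 indexes sigma_1, ..., sigma_(n-1) from 0. *)
Local Notation sg i := ((i, false) : 'I_n.-1 * bool).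

Inductive braid_rel : seq ('I_n.-1 * bool) -> seq ('I_n.-1 * bool) -> Prop :=
| BraidYB (i j : 'I_n.-1) : j = i.+1 :> nat ->
    braid_rel [:: sg i; sg j; sg i] [:: sg j; sg i; sg j]
| BraidComm (i j : 'I_n.-1) : (i + 2 <= j)%N || (j + 2 <= i)%N ->
    braid_rel [:: sg i; sg j] [:: sg j; sg i].

Definition braid_group : groupType := presented braid_rel.

Definition sigma (i : 'I_n.-1) : braid_group := pres_gen braid_rel i.

End Braid.

(* Main.v *)
(* The group presented by generators and relators is universal, so it suffices
   that the operators act_at R n i are bijective and satisfy the braid relations.
   Tensoring with id_V on the left shifts both relations along the strand index,
   so only i = 0 matters. There, reassociating to (V ⊗ (V ⊗ V)) ⊗ W turns the
   braid relation into the Yang-Baxter equation tensored with id_W, and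
   reassociating to (V ⊗ V) ⊗ W turns the commutation relation into
   (R ⊗ id)(id ⊗ f) = (id ⊗ f)(R ⊗ id). *)
Require Import Defs.
From HB Require Import structures.
From mathcomp Require Import all_boot all_order all_algebra.
From mathcomp Require Import reals complex.

Set Implicit Arguments.
Unset Strict Implicit.
Unset Printing Implicit Defensive.

Import GRing.Theory.

(** * Linear maps on tensor products and the associativity isomorphisms *)

Section TensorFacts.
Local Open Scope ring_scope.
Variable K : comNzRingType.

(** Linearity is a hypothesis on bare functions so that [f] and [g] can be inferred by unification
    from an equation between composite expressions. *)
Lemma tensor_eq (U V W : lmodType K) (f g : U ⊗ V -> W) :
    linear f -> linear g -> (forall u v, f (u ⊗ₜ v) = g (u ⊗ₜ v)) -> f =1 g.
Proof.
move=> fL gL; pose fm := GRing.isLinear.Build K _ W *:%R f fL.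
pose gm := GRing.isLinear.Build K _ W *:%R g gL.
pose f' : {linear (U ⊗ V) -> W} := HB.pack f fm.
pose g' : {linear (U ⊗ V) -> W} := HB.pack g gm.
exact: (@tensor_ext _ _ _ _ f' g').
Qed.

Lemma assocrK (U V W : lmodType K) : cancel (@assocr K U V W) assocl.
Proof.
apply: (tensor_eq (g := id)) => [a x y|//|t w]; first by rewrite !linearP.
move: t; apply: tensor_eq => [a x y|a x y|u v].
- by rewrite tensPl !linearP.
- exact: tensPl.
- by rewrite assocrE assoclE.
Qed.

Lemma assoclK (U V W : lmodType K) : cancel (@assocl K U V W) assocr.
Proof.
apply: (tensor_eq (g := id)) => [a x y|//|u t]; first by rewrite !linearP.
move: t; apply: tensor_eq => [a x y|a x y|v w].
- by rewrite tensPr !linearP.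
- exact: tensPr.
- by rewrite assoclE assocrE.
Qed.

Lemma tmap_comp (U U' U'' V V' V'' : lmodType K)
    (f : {linear U -> U'}) (f' : {linear U' -> U''})
    (g : {linear V -> V'}) (g' : {linear V' -> V''}) x :
  tmap f' g' (tmap f g x) = tmap (f' \o f) (g' \o g) x.
Proof.
move: x; apply: tensor_eq => [a x y|a x y|u v]; rewrite ?linearP //.
by rewrite !tmapE.
Qed.

Lemma eq_tmap (U U' V V' : lmodType K) (f f' : {linear U -> U'})
    (g g' : {linear V -> V'}) : f =1 f' -> g =1 g' -> tmap f g =1 tmap f' g'.
Proof.
by move=> ff gg; apply: tensor_ext => u v; rewrite !tmapE ff gg.
Qed.

Lemma tmap_id (U V : lmodType K) (f : {linear U -> U}) (g : {linear V -> V}) :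
  f =1 id -> g =1 id -> tmap f g =1 id.
Proof.
move=> f1 g1; apply: (tensor_eq (g := id)) => [a x y|//|u v].
  by rewrite linearP.
by rewrite tmapE f1 g1.
Qed.

Lemma tmap_bij (U V : lmodType K) (f : linear_aut U) (g : linear_aut V) :
  bijective (tmap f g).
Proof.
exists (tmap (linear_aut_inv f) (linear_aut_inv g)) => x;
  rewrite tmap_comp tmap_id //= => y.
- exact: linear_aut_funK.
- exact: linear_aut_funK.
- exact: linear_aut_inv_funK.
- exact: linear_aut_inv_funK.
Qed.

End TensorFacts.

(** * Braid relations and invertibility of the operators on tensor powers *)

Section Operators.
Local Open Scope ring_scope.
Variables (K : comNzRingType) (V : lmodType K).

Section Linear.
Variable R : {linear V ⊗ V -> V ⊗ V}.

Section Reassociation.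
Variable W : lmodType K.

Definition assoc3 : {linear (V ⊗ (V ⊗ V)) ⊗ W -> V ⊗ (V ⊗ (V ⊗ W))} :=
  tmap idfun assocr \o assocr.

Definition assoc3_inv : {linear V ⊗ (V ⊗ (V ⊗ W)) -> (V ⊗ (V ⊗ V)) ⊗ W} :=
  assocl \o tmap idfun assocl.

Lemma assoc3_invK : cancel assoc3_inv assoc3.
Proof.
move=> x; rewrite /= assoclK tmap_comp tmap_id //=.
exact: assoclK.
Qed.

(** Mac Lane's pentagon, evaluated at [(t ⊗ₜ z) ⊗ₜ w]; the three-arrow side ends with [assoc3]. *)
Lemma pentagon t z w : assocr (t ⊗ₜ (z ⊗ₜ w)) = assoc3 (assocr (t ⊗ₜ z) ⊗ₜ w).
Proof.
move: t; apply: tensor_eq => [a x y|a x y|u v] /=.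
- by rewrite tensPl linearP.
- by rewrite tensPl linearP tensPl !linearP.
- by rewrite !assocrE tmapE assocrE.
Qed.

Lemma act_head_assoc3 t w :
  act_head R (V ⊗ W) (assoc3 (t ⊗ₜ w)) = assoc3 (act_head R V t ⊗ₜ w).
Proof.
(* Writing [t] as a sum of terms [assocr (s ⊗ₜ z)] exposes the pair [s] on which [R] acts; the
   pentagon then carries both sides to [assocr (R s ⊗ₜ (z ⊗ₜ w))]. *)
rewrite -[t]assoclK; move: (assocl t).
apply: tensor_eq => [a x y|a x y|s z].
- by rewrite linearP tensPl !linearP.
- by rewrite !linearP tensPl linearP.
- by rewrite -pentagon /= !assocrK !tmapE /= pentagon.
Qed.

Lemma tail_head_assoc3 t w :
  tmap idfun (act_head R W) (assoc3 (t ⊗ₜ w)) = assoc3 (tmap idfun R t ⊗ₜ w).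
Proof.
move: t; apply: tensor_eq => [a x y|a x y|x s].
- by rewrite tensPl !linearP.
- by rewrite linearP tensPl linearP.
- by rewrite tmapE /= !assocrE !tmapE /= assocrK tmapE.
Qed.

Lemma yang_baxter_act_head : yang_baxter R ->
  act_head R (V ⊗ W) \o tmap idfun (act_head R W) \o act_head R (V ⊗ W)
  =1 tmap idfun (act_head R W) \o act_head R (V ⊗ W)
     \o tmap idfun (act_head R W).
Proof.
move=> hR x; rewrite -[x]assoc3_invK; move: (assoc3_inv x).
apply: tensor_eq => [a y z|a y z|t w]; rewrite ?linearP // /comp.
rewrite !(act_head_assoc3, tail_head_assoc3).
by have /= -> := hR t.
Qed.

Lemma act_head_tail (f : {linear W -> W}) :
  act_head R W \o tmap idfun (tmap idfun f)
  =1 tmap idfun (tmap idfun f) \o act_head R W.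
Proof.
move=> x; rewrite -[x]assoclK; move: (assocl x).
(* Naturality of [assocr] in its last factor: [f] acts on [w] only, while [R] will act on [t]
   only. *)
have tmap_assocr t w : tmap idfun (tmap idfun f) (assocr (t ⊗ₜ w)) =
    assocr (t ⊗ₜ f w) :> V ⊗ (V ⊗ W).
  move: t; apply: tensor_eq => [a y z|a y z|u v].
  - by rewrite tensPl !linearP.
  - by rewrite tensPl linearP.
  - by rewrite !assocrE !tmapE.
apply: tensor_eq => [a y z|a y z|t w]; rewrite ?linearP //=.
by rewrite tmap_assocr !assocrK !tmapE /= tmap_assocr.
Qed.

End Reassociation.

Lemma act_at_braid (n i : nat) : yang_baxter R -> (i.+2 < n)%N ->
  act_at R n i \o act_at R n i.+1 \o act_at R n i
  =1 act_at R n i.+1 \o act_at R n i \o act_at R n i.+1.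
Proof.
move=> hR; elim: i n => [|i IHi] [|[|[|n]]] // lt_in.
  (* On three strands the shifted operator is [id ⊗ R] itself and the claim is [hR]; with more
     strands, the factors after the third form [W]. *)
  case: n lt_in => [_ /=|n _]; first exact: hR.
  exact: yang_baxter_act_head.
move=> x; rewrite -[act_at R n.+3 i.+2]/(tmap idfun (act_at R n.+2 i.+1)).
rewrite -[act_at R n.+3 i.+1]/(tmap idfun (act_at R n.+2 i)).
rewrite /comp !tmap_comp.
apply: eq_tmap => [//|y]; exact: (IHi n.+2).
Qed.

Lemma act_at_comm (n i j : nat) : (i.+1 < j)%N -> (j.+1 < n)%N ->
  act_at R n i \o act_at R n j =1 act_at R n j \o act_at R n i.
Proof.
elim: i n j => [|i IHi] [|[|[|n]]] [|[|j]] // le_ij lt_jn.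
  (* Three strands leave no room for [j]; with at least four, the second operator is
     [id ⊗ (id ⊗ f)]. *)
  case: n lt_jn => [//|n] lt_jn.
  exact: act_head_tail.
move=> x; rewrite -[act_at R n.+3 j.+2]/(tmap idfun (act_at R n.+2 j.+1)).
rewrite -[act_at R n.+3 i.+1]/(tmap idfun (act_at R n.+2 i)).
rewrite /comp !tmap_comp.
apply: eq_tmap => [//|y]; exact: (IHi n.+2).
Qed.

End Linear.

Lemma act_head_bij (R : linear_aut (V ⊗ V)) (W : lmodType K) :
  bijective (act_head R W).
Proof.
apply: bij_comp; last by exists assocr; [exact: assoclK | exact: assocrK].
apply: bij_comp; first by exists assocl; [exact: assocrK | exact: assoclK].
exact: (tmap_bij R (linear_aut_one W)).
Qed.

Lemma act_at_bij (R : linear_aut (V ⊗ V)) (n i : nat) : bijective (act_at R n i).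
Proof.
elim: n i => [|n IHn] [|i]; try by exists id.
  case: n {IHn} => [|[|n]]; first by exists id.
    exact: linear_aut_bij.
  exact: act_head_bij.
case: n IHn => [|n] IHn; first by exists id.
exact: (tmap_bij (linear_aut_one V) (LinearAut (IHn i))).
Qed.

Definition act_aut (R : linear_aut (V ⊗ V)) (n i : nat) :
  linear_aut (tpow V n) := LinearAut (act_at_bij R n i).

End Operators.

(** * Homomorphisms between groups *)

Section MultiplicativeGroup.
Local Open Scope group_scope.
Variables (G H : groupType) (f : {multiplicative G -> H}).

(* gmulf1 and gmulfV do not apply: HB does not infer a UMagmaMorphism from a
   Multiplicative between groups. *)
Lemma multiplicative1 : f 1 = 1.
Proof. by apply: (mulgI (f 1)); rewrite -gmulfM !mulg1. Qed.

Lemma multiplicativeV : {morph f : x / x^-1}.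
Proof.
by move=> x; apply/esym/mulg1_eq; rewrite -gmulfM mulgV multiplicative1.
Qed.

End MultiplicativeGroup.

(** * Universal property of a presented group *)

Section PresentedUniversal.
Local Open Scope group_scope.
Local Open Scope quotient_scope.
Variables (I : choiceType) (rel : seq (I * bool) -> seq (I * bool) -> Prop).
Variable G : groupType.

Local Notation P := (presented rel : groupType).

Lemma presented_ext (f g : {multiplicative P -> G}) :
  (forall i, f (pres_gen rel i) = g (pres_gen rel i)) -> f =1 g.
Proof.
move=> fg x; rewrite -[x]reprK; elim: (repr x) => [|[i b] w IHw].
  exact: etrans (multiplicative1 f) (esym (multiplicative1 g)).
rewrite -cat1s -presented_mul_pi -[presented_mul _ _]/(_ * _ : P) !gmulfM IHw.
congr (_ * _); case: b; last exact: fg.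
(* Free cancellation makes the negative letter the inverse of the generator, so agreement on
   generators covers it. *)
have -> : \pi_(presented rel) [:: (i, true)] = (pres_gen rel i : P)^-1.
  apply/esym/mulg1_eq; rewrite [LHS]presented_mul_pi.
  by apply/presented_eqP; apply: (PresCancel _ i false).
apply: etrans (multiplicativeV f _) (etrans _ (esym (multiplicativeV g _))).
by rewrite fg.
Qed.

Variable h : I -> G.

Definition word_eval (w : seq (I * bool)) : G :=
  \prod_(x <- w) if x.2 then (h x.1)^-1 else h x.1.

Hypothesis h_rel : forall l r, rel l r -> word_eval l = word_eval r.

(** Makes evaluation independent of the representative chosen in [presented_lift]: cancelling pairs
    evaluate to 1 and relators agree by [h_rel]. *)
Lemma word_eval_pres_eq u v : pres_eq rel u v -> word_eval u = word_eval v.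
Proof.
elim=> {u v} [//|u v _ -> //|u v w _ -> _ -> //|||//].
- by move=> u u' v v' _ IHu _ IHv; rewrite /word_eval !big_cat; congr (_ * _).
- move=> i b; rewrite /word_eval big_cons big_seq1 big_nil /=.
  by case: b; rewrite /= ?mulgV ?mulVg.
Qed.

Definition presented_lift (x : P) : G := word_eval (repr x).

Lemma presented_lift_pi w : presented_lift (\pi_(presented rel) w) = word_eval w.
Proof. by apply/word_eval_pres_eq/presented_eqP; rewrite reprK. Qed.

Fact presented_lift_mul : {morph presented_lift : x y / x * y}.
Proof.
move=> x y; rewrite [presented_lift (x * y)]presented_lift_pi.
exact: big_cat.
Qed.

HB.instance Definition _ :=
  isMultiplicative.Build P G presented_lift presented_lift_mul.

Lemma presented_lift_gen i : presented_lift (pres_gen rel i) = h i.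
Proof. by rewrite presented_lift_pi /word_eval big_seq1. Qed.

Lemma presented_universal :
  exists f : {multiplicative P -> G}, forall i, f (pres_gen rel i) = h i.
Proof. by exists presented_lift; apply: presented_lift_gen. Qed.

End PresentedUniversal.

(** * The representation of the braid group *)

Lemma act_aut_braid_rel (K : comNzRingType) (V : lmodType K)
    (R : linear_aut (V ⊗ V)) (n : nat) (l r : seq ('I_n.-1 * bool)) :
  yang_baxter R -> braid_rel l r ->
  word_eval (fun i : 'I_n.-1 => act_aut R n i) l
  = word_eval (fun i : 'I_n.-1 => act_aut R n i) r.
Proof.
move=> hR; have lt_n (i : 'I_n.-1) : i.+1 < n by rewrite -ltn_predRL.
case=> [i j def_j|i j ij];
  rewrite /word_eval !big_cons !big_nil /= !mulg1; apply/linear_autP.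
  by move=> x; rewrite /= def_j; apply: act_at_braid; rewrite // -def_j.
(* [act_at_comm] wants the smaller index first, so the other order uses it reversed. *)
by move: ij; rewrite !addn2 => /orP[] ij x; [|symmetry]; apply: act_at_comm.
Qed.

Theorem lemma5p2 (F : realType) (V : lmodType (complex F))
    (R : linear_aut (V ⊗ V)) (hR : yang_baxter R) (n : nat) (hn : 2 <= n) :
  exists rho : {multiplicative braid_group n -> linear_aut (tpow V n)},
    (forall i : 'I_n.-1, rho (sigma i) =1 act_at R n i) /\
    (forall rho' : {multiplicative braid_group n -> linear_aut (tpow V n)},
       (forall i : 'I_n.-1, rho' (sigma i) =1 act_at R n i) -> rho' =1 rho).
Proof.
have [rho rhoE] := presented_universal
  (fun l r => @act_aut_braid_rel _ V R n l r hR).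
have rho_sigma i : rho (sigma i) =1 act_at R n i by move=> x; rewrite rhoE.
exists rho; split=> // rho' rho'E.
(* Uniqueness: a homomorphism is determined by its values on the generators. *)
apply: presented_ext => i; apply/linear_autP => x.
by rewrite rho'E rho_sigma.
Qed.
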